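(* $\mathfrak{sp}(\text{Borel}) = \mathfrak{sp}(\mathbf{\Sigma}^1_1) = \mathfrak{sp}(\mathbf{\Pi}^1_1) = \mathfrak{sp}(\mathbf{\Sigma}^1_2) = \mathfrak{sp}(\aleph_1\text{-Suslin})$.
   Context: For a pointclass $\Gamma$ of subsets of $\mathbb{R}$, $\mathfrak{sp}(\Gamma) = \{|\mathcal{P}| : \mathcal{P} \text{ is a partition of } \mathbb{R} \text{ into uncountably many sets in } \Gamma\}$. Here $\mathbf{\Sigma}^1_1$ (analytic), $\mathbf{\Pi}^1_1$ (coanalytic), $\mathbf{\Sigma}^1_2$, and $\aleph_1$-Suslin are the standard boldface projective/Suslin pointclasses. *)

(* Defs.v *)
From HB Require Import structures.
From mathcomp Require Import all_boot all_order all_algebra.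
From mathcomp Require Import all_classical all_reals all_analysis.

Set Implicit Arguments.
Unset Strict Implicit.
Unset Printing Implicit Defensive.

Local Open Scope classical_set_scope.
Local Open Scope card_scope.

(* K^omega with the product topology, K being discrete. *)
Definition seq_space (K : choiceType) : topologicalType :=
  prod_topology (fun _ : nat => discrete_topology K).

Definition Baire_space : topologicalType := seq_space nat.

Definition projection (X Y : topologicalType) (Gamma : set (set (X * Y))) :
    set (set X) :=
  [set fst @` C | C in Gamma].

Section Pointclasses.
Variable X : topologicalType.

Definition Borel : set (set X) := <<s [set U : set X | open U] >>.

Definition Sigma11 : set (set X) :=
  projection [set C : set (X * Baire_space) | closed C].

Definition Pi11 : set (set X) := [set A | Sigma11 (~` A)].

(* A is K-Suslin when it is the projection of a closed subset of X x K^omega;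
   only the cardinality of K matters. *)
Definition Suslin (K : choiceType) : set (set X) :=
  projection [set C : set (X * seq_space K) | closed C].

End Pointclasses.

Arguments Borel : clear implicits.
Arguments Sigma11 : clear implicits.
Arguments Pi11 : clear implicits.
Arguments Suslin : clear implicits.

Definition Sigma12 (X : topologicalType) : set (set X) :=
  projection (Pi11 (X * Baire_space)%type).

Arguments Sigma12 : clear implicits.

(* K has the least uncountable cardinality: it is uncountable, and all smaller
   cardinalities are countable. *)
Definition is_aleph1 (K : Type) : Prop :=
  ~ countable [set: K] /\ forall A : set K, countable A \/ A #= [set: K].

Definition aleph1_Suslin (X : topologicalType) : set (set X) :=
  [set A | exists2 K : choiceType, is_aleph1 K & Suslin X K A].

Arguments aleph1_Suslin : clear implicits.

(* The cardinal |A|, as the equinumerosity class of A among the subsets of T, so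
   that cardinality A = cardinality B if and only if A #= B. *)
Definition cardinality (T : Type) (A : set T) : set (set T) :=
  [set B | B #= A].

(* partition P id setT: the members of P are nonempty and pairwise disjoint, and
   they cover X. *)
Definition sp (X : topologicalType) (Gamma : set (set X)) :
    set (set (set (set X))) :=
  [set cardinality P | P in
    [set P : set (set X) |
      [/\ partition P id [set: X], ~ countable P & P `<=` Gamma]]].

(* Main.v *)
Require Import Defs.
From Stdlib Require Import Inverse_Image.
From mathcomp Require Import all_boot all_order all_algebra.
From mathcomp Require Import all_classical all_reals all_analysis.
From mathcomp Require Import wochoice borel_hierarchy.
Import Order.TTheory numFieldNormedType.Exports.

(* Everything lies between the Borel and the aleph_1-Suslin pointclass, so it is
   enough to refine a partition [P] into aleph_1-Suslin sets to a Borel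
   partition of the same cardinality. A witness in omega_1^omega is bounded,
   hence an aleph_1-Suslin set is a union of aleph_1 sets given by countable
   alphabets. Each of these is a union of aleph_1 Borel sets: the tree of
   attempts at [x], pruned transfinitely, stabilizes at some countable stage,
   and being stable with a surviving root at stage [a] is a Borel condition on
   [x]. A union of aleph_1 Borel sets can be made disjoint, since initial
   segments of omega_1 are countable. The refinement has at most
   |P| * aleph_1 = |P| members. The same pruning ranks a tree without branches
   in omega_1, and such rank functions serve as witnesses that Sigma^1_2 sets
   are aleph_1-Suslin. *)

Set Implicit Arguments.
Unset Strict Implicit.
Unset Printing Implicit Defensive.
Local Open Scope classical_set_scope.
Local Open Scope card_scope.

(** * Cardinal arithmetic *)

Definition injective_relation (T U : Type) (A : set T) (B : set U)
    (R : T -> U -> Prop) :=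
  (forall x, A x -> exists2 y, B y & R x y) /\
  (forall x x' y, A x -> A x' -> R x y -> R x' y -> x = x').

Lemma card_le_relP (T U : Type) (A : set T) (B : set U) :
  A #<= B <-> exists R, injective_relation A B R.
Proof.
split=> [/card_leP[f]|[R [Rtotal Rinj]]].
  exists (fun x y => exists a : A, val a = x /\ val (f a) = y); split.
    move=> x Ax; pose a : A := SigSub (mem_set Ax).
    by exists (val (f a)); [exact: set_valP|exists a].
  move=> _ _ _ _ _ [a [<- <-]] [a' [<- /val_inj faa']]; congr val.
  by apply: (inj (f := f)); rewrite ?inE.
rewrite -(card_le_eql (card_setT A)) -(card_le_eqr (card_setT B)).
have /choice[f fR] (a : A) : exists b : B, R (val a) (val b).
  have [y By Rxy] := Rtotal _ (set_valP a).
  by exists (SigSub (mem_set By)).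
have f_inj : {in [set: A] &, injective f}.
  move=> a a' _ _ faa'; apply: val_inj.
  apply: Rinj (set_valP a) (set_valP a') (fR a) _.
  by rewrite faa'; exact: fR.
by rewrite -(card_le_eql (inj_card_eq f_inj)) card_leT.
Qed.

Lemma card_le_rel_family (I T U : Type) (D : set I) (A : I -> set T)
    (B : I -> set U) : (forall i, D i -> A i #<= B i) ->
  exists R, forall i, D i -> injective_relation (A i) (B i) (R i).
Proof.
move=> AB.
have /choice[R RP] i : exists R, D i -> injective_relation (A i) (B i) R.
  have [/AB/card_le_relP[R RP]|nDi] := pselect (D i); first by exists R.
  by exists (fun _ _ => True).
by exists R.
Qed.

Lemma card_le_total (T U : Type) (A : set T) (B : set U) : A #<= B \/ B #<= A.
Proof.
pose partial_injection (G : set (T * U)) := G `<=` A `*` B /\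
  forall p q, G p -> G q -> p.1 = q.1 <-> p.2 = q.2.
have [|G [[GAB Ginj] Gmax]] := @Zorn_bigcup _ partial_injection.
  move=> F FP Ftotal; split; first by apply: bigcup_sub => G /FP[].
  move=> p q [G FG Gp] [G' FG' G'q].
  have [GG'|G'G] := Ftotal _ _ FG FG'.
  - by apply: (FP _ FG').2 => //; exact: GG'.
  - by apply: (FP _ FG).2 => //; exact: G'G.
have [domG|/existsNP[a /not_implyP[Aa nGa]]] :=
    pselect (forall a, A a -> exists b, G (a, b)).
  left; apply/card_le_relP; exists (fun a b => G (a, b)); split.
    by move=> x /domG[y Gxy]; exists y => //; have [] := GAB _ Gxy.
  by move=> x x' y _ _ Gxy Gx'y; apply/(Ginj _ _ Gxy Gx'y).
have [codG|/existsNP[b /not_implyP[Bb nGb]]] :=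
    pselect (forall b, B b -> exists a, G (a, b)).
  right; apply/card_le_relP; exists (fun b a => G (a, b)); split.
    by move=> y /codG[x Gxy]; exists x => //; have [] := GAB _ Gxy.
  by move=> y y' x _ _ Gxy Gxy'; apply/(Ginj _ _ Gxy Gxy').
exfalso; apply: (Gmax (G `|` [set (a, b)])).
  by split=> [p|/(_ (a, b) (or_intror erefl)) Gab]; [left|apply: nGa; exists b].
split=> [p [/GAB//|->]//|[x y] [x' y'] [Gxy|[-> ->]] [Gx'y'|[-> ->]] //=].
- exact: (Ginj _ _ Gxy Gx'y').
- by split=> e; [case: nGa; exists y|case: nGb; exists x]; rewrite -e.
- by split=> e; [case: nGa; exists y'|case: nGb; exists x']; rewrite e.
Qed.

Lemma card_le_cancel (T U : Type) (x0 : T) : [set: T] #<= [set: U] ->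
  exists (f : T -> U) (g : U -> T), cancel f g.
Proof.
move=> /pfcard_geP[T0|[g]].
  by have : [set: T] x0 by []; rewrite T0.
have /choice[f fK] x : exists y, g y = x.
  by have [y _ gy] := surj (f := g) (I : [set: T] x); exists y.
by exists f, g.
Qed.

Lemma card_leX (T T' U U' : Type) (A : set T) (A' : set T') (B : set U)
    (B' : set U') : A #<= A' -> B #<= B' -> A `*` B #<= A' `*` B'.
Proof.
move=> /card_le_relP[R [Rtotal Rinj]] /card_le_relP[S [Stotal Sinj]].
apply/card_le_relP; exists (fun p q => R p.1 q.1 /\ S p.2 q.2); split.
  move=> p [/Rtotal[x A'x Rx] /Stotal[y B'y Sy]].
  by exists (x, y).
move=> [x y] [x' y'] q [/= Ax By] [/= Ax' By'] [Rx Sy] [Rx' Sy'].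
by congr pair; [exact: Rinj Rx Rx'|exact: Sinj Sy Sy'].
Qed.

Lemma card_le_setXA (T U V : Type) (A : set T) (B : set U) (C : set V) :
  A `*` B `*` C #<= A `*` (B `*` C).
Proof.
apply/card_le_relP; exists (fun p q => q = (p.1.1, (p.1.2, p.2))); split.
  by move=> [[x y] z] [[Ax By] Cz]; exists (x, (y, z)).
by move=> [[x y] z] [[x' y'] z'] _ _ _ -> [-> -> ->].
Qed.

Lemma card_bigcup_le_setX (I T U : Type) (D : set I) (F : I -> set T)
    (M : set U) :
  (forall i, D i -> F i #<= M) -> \bigcup_(i in D) F i #<= D `*` M.
Proof.
move=> /card_le_rel_family[R RP].
apply/card_le_relP.
exists (fun x p => [/\ D p.1, F p.1 x & R p.1 x p.2]); split.
  move=> x [i Di Fix]; have [/(_ _ Fix)[y My Rxy] _] := RP i Di.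
  by exists (i, y).
move=> x x' [i y] _ _ [Di Fix Rxy] [_ Fix' Rx'y].
by have [_] := RP i Di; apply; [exact: Fix|exact: Fix'|exact: Rxy|exact: Rx'y].
Qed.

Lemma card_setX_le_bigcup (I T U : Type) (D : set I) (F : I -> set T)
    (M : set U) :
  trivIset D F -> (forall i, D i -> M #<= F i) ->
  D `*` M #<= \bigcup_(i in D) F i.
Proof.
move=> Ftriv /card_le_rel_family[R RP].
apply/card_le_relP; exists (fun p x => F p.1 x /\ R p.1 p.2 x); split.
  move=> [i y] [/= Di My]; have [/(_ _ My)[x Fix Rxy] _] := RP i Di.
  by exists x => //; exists i.
move=> [i y] [i' y'] x [/= Di My] [/= Di' My'] [Fix Ryx] [Fi'x Ry'x].
have ii' : i = i' by apply: Ftriv => //; exists x.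
rewrite -ii' in Ry'x *; congr pair.
by have [_] := RP i Di; apply; [exact: My|exact: My'|exact: Ryx|exact: Ry'x].
Qed.

Lemma exists_maximal_disjoint_copies (T U : Type) (A : set T) (M : set U) :
  M !=set0 -> M #<= A -> exists E : set (set T),
  [/\ E !=set0, trivIset E id, forall B, E B -> B `<=` A /\ B #= M
    & A `\` \bigcup_(B in E) B #<= M].
Proof.
move=> M0 MA.
have [E [EP Etriv Emax]] := ex_maximal_disjoint_subcollection id
  [set B : set T | B `<=` A /\ B #= M].
pose rest := A `\` \bigcup_(B in E) B.
have small_rest : ~ (M #<= rest).
  move=> /card_subP[C CM Crest].
  have Cdisj B x : E B -> B x -> C x -> False.
    by move=> EB Bx /Crest[_]; apply; exists B.
  apply: (Emax (E `|` [set C])).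
  - split=> [B|/(_ C (or_intror erefl)) EC]; first by left.
    have [y Cy] : C !=set0.
      apply/set0P; rewrite -(card_eq0 (U := U)) (card_eql CM) card_eq0.
      exact/set0P.
    exact: (Cdisj _ _ EC Cy Cy).
  - by move=> B [/EP//|->]; split=> // x /Crest[].
  - move=> B B' [EB|->] [EB'|->] // [x [Bx B'x]].
    + by apply: Etriv => //; exists x.
    + by case: (Cdisj B x).
    + by case: (Cdisj B' x).
have [restM|//] := card_le_total rest M.
exists E; split=> //; apply: contrapT => E0; apply: small_rest.
rewrite (_ : rest = A) // /rest (_ : E = set0) ?bigcup_set0 ?setD0 //.
by apply: contrapT => /eqP/set0P.
Qed.

(* [E] being a maximal disjoint family of copies of [M] in [A], the part of [A]
   that [E] misses counts as one more block, so that [A] is covered by a family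
   of |E * M| blocks of size at most |M|. *)
Lemma card_setX_absorb (T U : Type) (A : set T) (M : set U) :
  infinite_set M -> M `*` M #<= M -> M #<= A -> A `*` M #<= A.
Proof.
move=> Minf MM MA.
have [E [[B0 EB0] Etriv Ecopy restM]] :=
  exists_maximal_disjoint_copies (infinite_setN0 Minf) MA.
set rest := A `\` _ in restM.
have EMM : E `*` M `*` M #<= E `*` M.
  exact: card_le_trans (card_le_setXA _ _ _) (card_leX (card_lexx _) MM).
have AE : A #<= (rest |` E) `*` M.
  rewrite {1}(_ : A = \bigcup_(B in rest |` E) B).
    by apply: card_bigcup_le_setX => B [->//|/Ecopy[_ /card_eqPle[]]].
  rewrite bigcup_setU1 setUC setDUK //.
  by apply: bigcup_sub => B /Ecopy[].
have Eblocks : rest |` E #<= E `*` M.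
  have [m0 Mm0] := infinite_setN0 Minf.
  have [m1 [Mm1 m10]] := infinite_setN0 (infinite_setD Minf (finite_set1 m0)).
  apply/card_le_relP; exists (fun B p =>
    (E B /\ p = (B, m0)) \/ (B = rest /\ p = (B0, m1))); split.
    move=> B [->|EB]; first by exists (B0, m1) => //; right.
    by exists (B, m0) => //; left.
  move=> B B' p _ _ [[_ ->]|[-> ->]] [[_ pE]|[-> pE]] //; case: pE => // _.
  by move=> /esym/m10.
have EA : E `*` M #<= A.
  have Ege B : E B -> M #<= B by move=> /Ecopy[_ /card_eqPle[]].
  apply: card_le_trans (card_setX_le_bigcup Etriv Ege) (subset_card_le _).
  by apply: bigcup_sub => B /Ecopy[].
apply: card_le_trans EA; apply: card_le_trans (card_leX AE (card_lexx _)) _.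
by do 2![apply: (card_le_trans _ EMM); apply: card_leX => //].
Qed.

Lemma infinite_setX_nat (T : Type) (A : set T) :
  infinite_set A -> A `*` [set: nat] #<= A.
Proof.
move=> /infiniteP; apply: card_setX_absorb; first exact: infinite_nat.
by rewrite setXTT; have /card_eqPle[] := card_nat2.
Qed.

Lemma uncountable_infinite (T : Type) (A : set T) :
  ~ countable A -> infinite_set A.
Proof. by move=> ucA /finite_set_countable. Qed.

Lemma is_aleph1_card_le (K T : Type) (A : set T) :
  is_aleph1 K -> ~ countable A -> [set: K] #<= A.
Proof.
move=> [_ K1] ucA; have [AK|//] := card_le_total A [set: K].
have /card_subP[C CA _] := AK; have [cC|CK] := K1 C.
  by case: ucA; rewrite -(eq_countable CA).
by rewrite -(card_le_eql CK) (card_le_eql CA).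
Qed.

Lemma not_card_le_powerset (T : Type) : ~ ([set: set T] #<= [set: T]).
Proof.
move=> /(card_le_cancel set0)[f [g fK]]; pose D := [set x | ~ g x x].
have : D (f D) <-> ~ D (f D) by rewrite {1}/D /= fK.
tauto.
Qed.

(** * The first uncountable ordinal *)

Lemma well_founded_minimal (K : Type) (lt : K -> K -> Prop) (A : set K) :
  well_founded lt -> A !=set0 -> exists2 a, A a & forall b, A b -> ~ lt b a.
Proof.
move=> wf [a]; elim/(well_founded_ind wf) : a => a IH Aa.
have [[b Ab ba]|nb] := pselect (exists2 b, A b & lt b a); first exact: (IH b).
by exists a => // b Ab ba; apply: nb; exists b.
Qed.

Definition strict_well_order (K : Type) (lt : K -> K -> Prop) :=
  [/\ well_founded lt, forall y x z, lt x y -> lt y z -> lt x z &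
      forall x y, [\/ x = y, lt x y | lt y x]].

Record omega1_order (K : Type) (lt : K -> K -> Prop) : Prop := Omega1Order {
  omega1_well_order : strict_well_order lt;
  omega1_countable_lt : forall x, countable [set y | lt y x];
  omega1_uncountable : ~ countable [set: K]
}.

Section WellOrder.
Variables (T : eqType) (R : rel T).
Hypothesis R_wo : well_order R.

Let R_wo_chain : wo_chain R predT. Proof. by move=> A _; exact: R_wo. Qed.

Lemma well_order_total : total R.
Proof. by move=> x y; exact: (wo_chainW R_wo_chain). Qed.

Lemma well_order_anti : antisymmetric R.
Proof. by move=> x y; exact: (wo_chain_antisymmetric R_wo_chain). Qed.

Lemma well_order_trans : transitive R.
Proof.
move=> y x z xy yz.
have [|w [[+ wmin] _]] := R_wo (A := [pred t | [|| t == x, t == y | t == z]]).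
  by exists x; rewrite inE eqxx.
have [wx [wy wz]] : R w x /\ R w y /\ R w z.
  by do !split; apply: wmin; rewrite inE eqxx ?orbT.
rewrite inE => /or3P[] /eqP w_eq; rewrite {}w_eq {wmin} in wx wy wz => //.
  by rewrite (@well_order_anti x y) // xy wx.
by rewrite -(@well_order_anti y z) // yz wy.
Qed.

Lemma well_order_strict : strict_well_order (fun x y => R x y /\ x <> y).
Proof.
set lt := fun x y => _; split.
- move=> x0; apply: contrapT => nacc_x0.
  have [|x [[+ xmin] _]] := R_wo (A := [pred t | `[< ~ Acc lt t >]]).
    by exists x0; apply/asboolP.
  move=> /asboolP; apply; split=> y [yx y_neq_x]; apply: contrapT => nacc_y.
  apply: y_neq_x; apply: well_order_anti; rewrite yx xmin //.
  exact/asboolP.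
- move=> y x z [xy x_neq_y] [yz _]; split; first exact: well_order_trans yz.
  by move=> xz; apply: x_neq_y; apply: well_order_anti; rewrite xy xz.
- move=> x y; have [->|/eqP x_neq_y] := eqVneq x y; first exact: Or31.
  have /orP[xy|yx] := well_order_total x y; first by apply: Or32.
  by apply: Or33; split=> // /esym.
Qed.

End WellOrder.

Lemma uncountable_omega1_order (T : choiceType) : ~ countable [set: T] ->
  exists (K : choiceType) (lt : K -> K -> Prop), omega1_order lt.
Proof.
move=> ucT; have [R /well_order_strict[]] := well_ordering_principle T.
set lt := fun x y => _ => wf tr tri.
pose D := [set x | countable [set y | lt y x]].
have ucD : ~ countable D.
  have [allD|] := pselect (forall x, D x).
    by rewrite (_ : D = [set: T])//; apply/seteqP; split.
  move=> /existsNP[x]; elim/(well_founded_ind wf) : x => x IH nDx.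
  have [ltxD|] := pselect (forall y, lt y x -> D y).
    by move=> cD; apply: nDx; apply: sub_countable cD; exact: subset_card_le.
  by move=> /existsNP[y /not_implyP[/IH]].
exists (set_type D : choiceType), (fun x y => lt (val x) (val y)); split.
- split; first exact: (@wf_inverse_image D T lt).
    by move=> y x z; exact: tr.
  move=> x y; have [/val_inj ->|xy|yx] := tri (val x) (val y).
  + exact: Or31.
  + exact: Or32.
  + exact: Or33.
- move=> x; apply: sub_countable (set_valP x).
  have valI : {in [set y : D | lt (val y) (val x)] &, injective val}.
    by move=> y z _ _; exact: val_inj.
  rewrite -(card_le_eql (inj_card_eq valI)).
  by apply: subset_card_le => _ [y yx <-].
- by rewrite (eq_countable (card_setT D)).
Qed.

Lemma exists_omega1_order :
  exists (K : choiceType) (lt : K -> K -> Prop), omega1_order lt.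
Proof. exact: uncountable_omega1_order (@not_card_le_powerset nat). Qed.

Section Omega1.
Variables (K : Type) (lt : K -> K -> Prop).
Hypothesis lt_omega1 : omega1_order lt.
Implicit Types (A : set K) (x y : K).

Lemma omega1_wf : well_founded lt.
Proof. by have [[]] := lt_omega1. Qed.

Lemma omega1_trans y x z : lt x y -> lt y z -> lt x z.
Proof. by have [[_ + _] _ _] := lt_omega1; apply. Qed.

Lemma omega1_trichotomy x y : [\/ x = y, lt x y | lt y x].
Proof. by have [[]] := lt_omega1. Qed.

Definition omega1_upto x : set K := [set y | y = x \/ lt y x].

Lemma omega1_upto_total x y : omega1_upto x y \/ omega1_upto y x.
Proof.
have [->|xy|yx] := omega1_trichotomy x y.
- by left; left.
- by right; right.
- by left; right.
Qed.

Lemma omega1_countable_upto x : countable (omega1_upto x).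
Proof.
rewrite (_ : omega1_upto x = [set x] `|` [set y | lt y x]) // -bigcup2E.
apply: bigcup_countable => // -[|[|i]] _ //=.
exact: omega1_countable_lt.
Qed.

Lemma omega1_bounded A : countable A -> exists x, forall y, A y -> lt y x.
Proof.
move=> cA; apply: contrapT => /forallNP nbA.
apply: (omega1_uncountable lt_omega1).
rewrite (_ : [set: K] = \bigcup_(y in A) omega1_upto y).
  by apply: bigcup_countable => // y _; exact: omega1_countable_upto.
apply/seteqP; split=> // x _.
have /existsNP[y /not_implyP[Ay nyx]] := nbA x; exists y => //.
by have [->|//|xy] := omega1_trichotomy y x; [left|right].
Qed.

Lemma omega1_inhabited : inhabited K.
Proof. by have [x _] := omega1_bounded (countable0 K). Qed.

Lemma omega1_infinite : infinite_set [set: K].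
Proof. exact/uncountable_infinite/(omega1_uncountable lt_omega1). Qed.

Lemma omega1_sqr : [set: K * K] #<= [set: K].
Proof.
apply: (@card_le_trans _ _ _ ([set: K] `*` [set: nat])); last first.
  exact/infinite_setX_nat/omega1_infinite.
rewrite (_ : [set: K * K] = \bigcup_x (omega1_upto x `*` omega1_upto x)).
  apply: card_bigcup_le_setX => x _.
  by apply: countableX; exact: omega1_countable_upto.
apply/seteqP; split=> // -[y z] _.
have [zy|yz] := omega1_upto_total y z; [exists y|exists z] => //.
  by split=> //; left.
by split=> //; left.
Qed.

Lemma omega1_is_aleph1 : is_aleph1 K.
Proof.
split=> [|A]; first exact: omega1_uncountable lt_omega1.
have [cA|ucA] := pselect (countable A); [by left|right].
apply/card_eqPle; split; first exact: card_leT.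
apply: card_le_trans (infinite_setX_nat (uncountable_infinite ucA)).
rewrite (_ : [set: K] = \bigcup_(x in A) omega1_upto x).
  by apply: card_bigcup_le_setX => x _; exact: omega1_countable_upto.
apply/seteqP; split=> // y _; apply: contrapT => Ay; apply: ucA.
apply: sub_countable (omega1_countable_upto y); apply: subset_card_le => x Ax.
by have [//|yx] := omega1_upto_total y x; case: Ay; exists x.
Qed.

Lemma uncountable_setX_omega1 (T : Type) (P : set T) :
  ~ countable P -> P `*` [set: K] #<= P.
Proof.
move=> ucP; apply: card_setX_absorb.
- exact: omega1_infinite.
- by rewrite setXTT; exact: omega1_sqr.
- exact: is_aleph1_card_le omega1_is_aleph1 ucP.
Qed.

End Omega1.

(** * Branches and transfinite pruning *)

Section Sequences.
Variable T : Type.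
Implicit Types (g h : nat -> T) (m n : nat).

Lemma eq_mkseqP g h n :
  mkseq g n = mkseq h n <-> forall i, (i < n)%N -> g i = h i.
Proof.
split=> [gh i ltin|gh]; last first.
  by apply/eq_in_map => i; rewrite mem_iota add0n => /andP[_ /gh].
by rewrite -(nth_mkseq (g i) g ltin) gh nth_mkseq.
Qed.

Lemma take_mkseq g m n : (m <= n)%N -> take m (mkseq g n) = mkseq g m.
Proof. by move=> mn; rewrite /mkseq -map_take take_iota (minn_idPl mn). Qed.

Lemma mkseqSl g n : mkseq g n.+1 = g 0%N :: mkseq (fun m => g m.+1) n.
Proof. by rewrite /mkseq /= -[1%N]add1n iotaDl -map_comp. Qed.

Lemma map_mkseq (U : Type) (f : T -> U) g n :
  map f (mkseq g n) = mkseq (f \o g) n.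
Proof. by rewrite -map_comp. Qed.

Lemma countable_seq : countable [set: T] -> countable [set: seq T].
Proof. by move=> /Pcountable[T' ->]. Qed.

End Sequences.

Definition has_branch (T : Type) (P : seq T -> Prop) :=
  exists g : nat -> T, forall n, P (mkseq g n).

Definition prefix_closed (T : Type) (P : seq T -> Prop) :=
  forall s t, P (s ++ t) -> P s.

Lemma has_branch_extend (T : Type) (P : seq T -> Prop) :
  P [::] -> (forall s, P s -> exists i, P (rcons s i)) -> has_branch P.
Proof.
move=> P0 PS; have [i0 _] := PS _ P0.
have /choice[next nextP] s : exists i, P s -> P (rcons s i).
  have [/PS[i Pi]|nP] := pselect (P s); first by exists i.
  by exists i0.
pose node n := iter n (fun s => rcons s (next s)) [::].
exists (next \o node) => n.
suff -> : mkseq (next \o node) n = node n by elim: n => //= n; exact: nextP.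
by elim: n => // n IHn; rewrite mkseqS IHn.
Qed.

Section Pruning.
Variables (K : Type) (lt : K -> K -> Prop).
Hypothesis lt_omega1 : omega1_order lt.
Variables (T : Type) (P : seq T -> Prop).
Hypothesis T_countable : countable [set: T].

(* [pruned a s]: the node [s] of the tree [P] does not survive [a] rounds of
   removing the nodes that have no children left. *)
Inductive pruned : K -> seq T -> Prop :=
| pruned_outside a s : ~ P s -> pruned a s
| pruned_childless a b s :
    lt b a -> (forall i, pruned b (rcons s i)) -> pruned a s.

Definition stable_stage a := forall s,
  (forall i, pruned a (rcons s i)) -> pruned a s.

Lemma prunedP a s :
  pruned a s <-> ~ P s \/ exists2 b, lt b a & forall i, pruned b (rcons s i).
Proof.
split=> [|[nPs|[b ba sb]]]; last exact: pruned_childless sb.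
  by case=> {a s} [a s nPs|a b s ba sb]; [left|right; exists b].
exact: pruned_outside.
Qed.

Lemma pruned_lt a b s : lt a b -> pruned a s -> pruned b s.
Proof.
move=> ab /prunedP[nPs|[c ca sc]]; first exact: pruned_outside.
by apply: pruned_childless sc; exact: omega1_trans ab.
Qed.

Lemma branch_not_pruned g : (forall n, P (mkseq g n)) ->
  forall a n, ~ pruned a (mkseq g n).
Proof.
move=> Pg a n; move: {-1}(mkseq g n) (erefl (mkseq g n)) => s + pr.
elim: pr n => {a s} [a s nPs|a b s _ _ IH] n sE; first by rewrite -sE in nPs.
by apply: (IH (g n) n.+1); rewrite mkseqS sE.
Qed.

Lemma stable_stage_branch a :
  stable_stage a -> ~ pruned a [::] -> has_branch P.
Proof.
move=> a_stable nroot.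
have [||g gP] := @has_branch_extend _ (fun s => ~ pruned a s) => //.
  move=> s ns; apply: contrapT => /forallNP all_pruned.
  by apply: ns; apply: a_stable => i; exact: contrapT.
exists g => n; apply: contrapT => nPg.
by apply: (gP n); exact: pruned_outside.
Qed.

Lemma exists_stable_stage : exists a, stable_stage a.
Proof.
have [a0] := omega1_inhabited lt_omega1.
have /choice[h hP] s : exists a, (exists b, pruned b s) -> pruned a s.
  have [[b bs]|ns] := pselect (exists b, pruned b s); first by exists b.
  by exists a0.
have [|a aP] := omega1_bounded lt_omega1 (A := range h).
  by apply: sub_countable (card_image_le h setT) _; exact: countable_seq.
have [b bP] := omega1_bounded lt_omega1 (countable1 a).
exists a => s children; apply: (@pruned_lt (h s)); first by apply: aP; exists s.
by apply: hP; exists b; apply: pruned_childless children; exact: bP.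
Qed.

Lemma has_branch_stableP :
  has_branch P <-> exists2 a, stable_stage a & ~ pruned a [::].
Proof.
split=> [[g Pg]|[a]]; last exact: stable_stage_branch.
have [a a_stable] := exists_stable_stage; exists a => //.
exact: (branch_not_pruned Pg (n := 0%N)).
Qed.

Lemma pruned_rcons a s i :
  prefix_closed P -> pruned a s -> pruned a (rcons s i).
Proof.
move=> P_closed /prunedP[nPs|[b ba sb]].
  by apply: pruned_outside; rewrite -cats1 => /P_closed.
exact: pruned_lt ba (sb i).
Qed.

Lemma no_branch_rankP : prefix_closed P ->
  ~ has_branch P <-> exists f : seq T -> K,
    forall s i, P (rcons s i) -> lt (f (rcons s i)) (f s).
Proof.
move=> P_closed; split=> [nbr|[f f_rank] [g Pg]]; last first.
  suff no_value a n : f (mkseq g n) <> a by exact: (no_value _ 0%N erefl).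
  elim/(well_founded_ind (omega1_wf lt_omega1)) : a n => a IH n fa.
  apply: (IH _ _ n.+1 erefl).
  by rewrite -fa mkseqS; apply: f_rank; rewrite -mkseqS.
have [a a_stable] := exists_stable_stage.
have all_pruned s : pruned a s.
  elim/last_ind: s => [|s i]; last exact: pruned_rcons.
  by apply: contrapT => /(stable_stage_branch a_stable).
have lt_wf := omega1_wf lt_omega1.
have /choice[f fP] s : exists b, pruned b s /\ forall c, pruned c s -> ~ lt c b.
  have [|b bs bmin] := well_founded_minimal (A := pruned^~ s) lt_wf.
    by exists a.
  by exists b.
exists f => s i Psi; have [/prunedP[nPs|[b bs sb]] _] := fP s.
  by case: nPs; move: Psi; rewrite -cats1 => /P_closed.
have [_ fsi_min] := fP (rcons s i).
have [->//|fsi_b|/(fsi_min _ (sb i))//] :=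
  omega1_trichotomy lt_omega1 (f (rcons s i)) b.
exact: omega1_trans fsi_b bs.
Qed.

End Pruning.

(** * Suslin sets *)

Definition suslin_operation (X K : Type) (F : seq K -> set X) : set X :=
  [set x | has_branch (F ^~ x)].

Section Cylinders.
Variables (X : topologicalType) (K : choiceType).
Implicit Types (C : set (X * seq_space K)) (g : seq_space K).

Lemma nbhs_cylinder g n :
  nbhs g [set h : seq_space K | mkseq h n = mkseq g n].
Proof.
elim: n => [|n IHn]; first exact: filterS filterT.
have gn : nbhs (g n : discrete_topology K) [set g n] by exact: discrete_set1.
have proj_n := @proj_continuous _ (fun _ : nat => discrete_topology K) n g _ gn.
apply: filterS (filterI IHn proj_n) => h [hg hgn].
by rewrite /= !mkseqS hg -hgn.
Qed.

Lemma nbhs_seq_space g U : nbhs g U ->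
  exists n, [set h : seq_space K | mkseq h n = mkseq g n] `<=` U.
Proof.
pose cylinders := filter_from [set: nat]
  (fun n => [set h : seq_space K | mkseq h n = mkseq g n]).
have cylinders_filter : Filter cylinders.
  apply: filter_from_filter; first by exists 0%N.
  move=> i j _ _; exists (maxn i j) => // h /= hg; split => /=.
    by rewrite -!(take_mkseq _ (leq_maxl i j)) hg.
  by rewrite -!(take_mkseq _ (leq_maxr i j)) hg.
suff cylinders_cvg : cylinders --> g by move=> /cylinders_cvg[n _ nU]; exists n.
apply/cvg_sup => i; apply/cvg_image.
  by apply/seteqP; split=> // y _; exists (fun=> y).
move=> V /nbhs_singleton Vg /=.
exists [set h : seq_space K | V (h i)].
  by exists i.+1 => // h /eq_mkseqP/(_ i (ltnSn i)) /= ->; exact: Vg.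
by apply/seteqP; split=> [_ [h Vh <-]//|y Vy]; exists (fun=> y).
Qed.

Definition cylinder_projection C (s : seq K) : set X :=
  closure [set x | exists h : nat -> K, C (x, h) /\ mkseq h (size s) = s].

Lemma cylinder_projectionS C D s t :
  C `<=` D -> cylinder_projection C (s ++ t) `<=` cylinder_projection D s.
Proof.
move=> CD; apply: closureS => x [h [Ch hst]]; exists h; split; first exact: CD.
rewrite size_cat in hst.
by rewrite -(take_mkseq _ (leq_addr (size t) (size s))) hst take_size_cat.
Qed.

Lemma closed_cylinder_projectionP C x g :
  closed C -> C (x, g) <-> forall n, cylinder_projection C (mkseq g n) x.
Proof.
move=> cC; split=> [Cxg n|xg].
  by apply: subset_closure; exists g; rewrite size_mkseq.
apply: cC => W [[U V] [/= Ux Vg] UVW]; have [n nV] := nbhs_seq_space Vg.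
have [x' [[h [Ch]]]] := xg n _ Ux; rewrite size_mkseq => hg Ux'.
by exists (x', h); split=> //; apply: UVW; split=> //=; exact: nV.
Qed.

Lemma Suslin_closed_scheme (A : set X) : Suslin X K A ->
  exists F : seq K -> set X, [/\ forall s, closed (F s),
    forall s t, F (s ++ t) `<=` F s & A = suslin_operation F].
Proof.
move=> [C cC <-]; exists (cylinder_projection C); split.
- by move=> s; exact: closed_closure.
- by move=> s t; exact: cylinder_projectionS.
- apply/seteqP; split=> [_ [[x g] Cxg <-]|x [g Fg]] /=.
    by exists g; exact/closed_cylinder_projectionP.
  by exists (x, g) => //; exact/closed_cylinder_projectionP.
Qed.

Lemma closed_scheme_Suslin (F : seq K -> set X) :
  (forall s, closed (F s)) -> Suslin X K (suslin_operation F).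
Proof.
move=> cF; exists [set p : X * seq_space K | forall n, F (mkseq p.2 n) p.1].
  move=> -[x g] xg n /=; apply: cF => U Ux.
  have [|[x' h] [/= Fh [Ux' /= hg]]] :=
      xg (U `*` [set h : seq_space K | mkseq h n = mkseq g n]).
    by exists (U, [set h : seq_space K | mkseq h n = mkseq g n]) => //=;
      split=> //; exact: nbhs_cylinder.
  by exists x'; split=> //; rewrite -hg.
apply/seteqP; split=> [_ [[x g] Fg <-]|x [g Fg]]; first by exists g.
by exists (x, g).
Qed.

End Cylinders.

Lemma Suslin_set0 (X : topologicalType) (K : choiceType) : Suslin X K set0.
Proof. by exists set0; [exact: closed0|exact: image_set0]. Qed.

Lemma Suslin_card_le (X : topologicalType) (K K' : choiceType) :
  [set: K'] #<= [set: K] -> Suslin X K' `<=` Suslin X K.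
Proof.
move=> K'K _ [C cC <-].
have [[[x0 g0] _]|/set0P/negP/negPn/eqP ->] := pselect (C !=set0); last first.
  by rewrite image_set0; exact: Suslin_set0.
have /Suslin_closed_scheme[F [cF _ ->]] : Suslin X K' (fst @` C) by exists C.
have [h [f hK]] := card_le_cancel (g0 0%N : K') K'K.
rewrite (_ : suslin_operation F = suslin_operation (F \o map f)).
  by apply: closed_scheme_Suslin => s; exact: cF.
apply/seteqP; split=> x [g Fg].
  exists (h \o g) => n; rewrite /= map_mkseq (@eq_mkseq _ _ g) // => m.
  exact: hK.
by exists (f \o g) => n; rewrite -map_mkseq; exact: Fg.
Qed.

Lemma Suslin_preimage (X Y : topologicalType) (K : choiceType) (f : X -> Y)
    (A : set Y) : continuous f -> Suslin Y K A -> Suslin X K (f @^-1` A).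
Proof.
move=> f_continuous /Suslin_closed_scheme[F [cF _ ->]].
apply: (@closed_scheme_Suslin _ _ (fun s => f @^-1` F s)) => s.
by apply: closed_comp (cF s) => x _; exact: f_continuous.
Qed.

Lemma Suslin_bigcup (X : topologicalType) (K : choiceType) (A : K -> set X) :
  (forall k, Suslin X K (A k)) -> Suslin X K (\bigcup_k A k).
Proof.
move=> /(fun AK k => Suslin_closed_scheme (AK k))/choice[F FP].
pose G s := if s is k :: s' then F k s' else setT.
rewrite (_ : \bigcup_k _ = suslin_operation G).
  apply: closed_scheme_Suslin => -[|k s]; first exact: closedT.
  by have [cF _ _] := FP k; exact: cF.
apply/seteqP; split=> x.
  move=> [k _]; have [_ _ ->] := FP k; move=> [g Fg].
  exists (fun m => if m is m'.+1 then g m' else k) => -[|n] //.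
  by rewrite mkseqSl.
move=> [g Gg]; exists (g 0%N) => //; have [_ _ ->] := FP (g 0%N).
by exists (fun m => g m.+1) => n; have := Gg n.+1; rewrite mkseqSl.
Qed.

Section Witnesses.
Variables (X : topologicalType) (K : choiceType) (k0 : K).

Lemma closed_Suslin (A : set X) : closed A -> Suslin X K A.
Proof.
move=> cA; rewrite (_ : A = suslin_operation (fun _ : seq K => A)).
  exact: closed_scheme_Suslin.
by apply/seteqP; split=> x => [Ax|[_ /(_ 0%N)//]]; exists (fun=> k0).
Qed.

Lemma closed_conditions_Suslin (J : countType) (I : Type)
    (Phi : I -> (J -> K) -> set X) (support : I -> seq J) :
  (forall i q, closed (Phi i q)) ->
  (forall i q q', {in support i, q =1 q'} -> Phi i q = Phi i q') ->
  Suslin X K [set x | exists q, forall i, Phi i q x].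
Proof.
move=> cPhi localPhi.
pose witness (s : seq K) (j : J) := nth k0 s (pickle j).
pose bound i := (\max_(j <- support i) pickle j).+1.
have witnessE i (g : nat -> K) n : (bound i <= n)%N ->
    Phi i (witness (mkseq g n)) = Phi i (g \o pickle).
  move=> bn; apply: localPhi => j ij; rewrite /witness nth_mkseq //.
  by apply: leq_trans bn; rewrite ltnS (@leq_bigmax_seq _ _ _ pickle).
pose F s := \bigcap_(i in [set i | (bound i <= size s)%N]) Phi i (witness s).
rewrite (_ : mkset _ = suslin_operation F).
  by apply: closed_scheme_Suslin => s; apply: closed_bigI => i _; exact: cPhi.
apply/seteqP; split=> x [q xq].
  exists (fun m => if unpickle m is Some j then q j else k0) => n i /=.
  rewrite size_mkseq => /witnessE ->.
  by rewrite (_ : _ \o _ = q) //; apply/funext => j /=; rewrite pickleK.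
exists (q \o pickle) => i; rewrite -(witnessE i q (bound i)) //.
by apply: xq; rewrite /mkset size_mkseq.
Qed.

(* The branches that put [x] in each of the sets [Phi i q] are made part of the
   witness. *)
Lemma conditions_Suslin (J I : countType) (Phi : I -> (J -> K) -> set X)
    (support : I -> seq J) :
  (forall i q, Suslin X K (Phi i q)) ->
  (forall i q q', {in support i, q =1 q'} -> Phi i q = Phi i q') ->
  Suslin X K [set x | exists q, forall i, Phi i q x].
Proof.
move=> SPhi localPhi.
have /choice[tree treeP] A : exists F : seq K -> set X, Suslin X K A ->
    (forall s, closed (F s)) /\ A = suslin_operation F.
  have [/Suslin_closed_scheme[F [cF _ AF]]|nA] := pselect (Suslin X K A).
    by exists F.
  by exists (fun=> set0).
pose Psi (c : I * nat) (q : J + I * nat -> K) :=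
  tree (Phi c.1 (q \o inl)) (mkseq (fun m => q (inr (c.1, m))) c.2).
rewrite (_ : mkset _ = [set x | exists q, forall c, Psi c q x]).
  apply: (@closed_conditions_Suslin _ _ _ (fun c =>
    map inl (support c.1) ++ [seq inr (c.1, m) | m <- iota 0 c.2])).
    by move=> c q; have [cF _] := treeP _ (SPhi c.1 (q \o inl)); exact: cF.
  move=> [i n] q q' qq'; rewrite /Psi /=.
  rewrite (localPhi i (q \o inl) (q' \o inl)) => [|j ij].
    congr (tree _ _); apply/eq_mkseqP => m mn; apply: qq'.
    by rewrite mem_cat orbC map_f // mem_iota.
  by apply: qq'; rewrite mem_cat map_f.
apply/seteqP; split=> x [q xq].
  have /choice[g gP] i : has_branch (fun s => tree (Phi i q) s x).
    by have := xq i; have [_ {1}->] := treeP _ (SPhi i q).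
  pose q' (j : J + I * nat) :=
    match j with inl j => q j | inr (i, m) => g i m end.
  by exists q' => -[].
exists (q \o inl) => i; have [_ ->] := treeP _ (SPhi i (q \o inl)).
by exists (fun m => q (inr (i, m))) => n; exact: (xq (i, n)).
Qed.

Lemma Suslin_bigcap (I : countType) (A : I -> set X) :
  (forall i, Suslin X K (A i)) -> Suslin X K (\bigcap_i A i).
Proof.
move=> SA; rewrite (_ : \bigcap_i _ =
    [set x | exists q : nat -> K, forall i, A i x]).
  exact: (@conditions_Suslin _ _ (fun i _ => A i) (fun=> [::])).
apply/seteqP; split=> x => [xA|[_ xA] i _]; last exact: xA.
by exists (fun=> k0) => i; exact: xA.
Qed.

End Witnesses.

(* [G s u] is the set of [x] for which the node [s] belongs to the tree that
   searches for a witness of [(x, w) \in A], as far as the prefix [u] of [w]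
   can tell. *)
Lemma Suslin_section_tree (X : topologicalType) (K L : choiceType)
    (A : set (X * seq_space L)) :
  Suslin _ K A -> exists G : seq K -> seq L -> set X,
  [/\ forall s u, closed (G s u),
      forall s t u v, G (s ++ t) (u ++ v) `<=` G s u &
      forall x w, A (x, w) <-> has_branch (fun s => G s (mkseq w (size s)) x)].
Proof.
move=> /Suslin_closed_scheme[F [cF Fmon ->]].
exists (fun s => cylinder_projection (F s)); split=> [s u|s t u v|x w].
- exact: closed_closure.
- by apply: cylinder_projectionS; exact: Fmon.
split=> -[g gP]; exists g => n.
  rewrite size_mkseq.
  exact: (closed_cylinder_projectionP x w (cF _)).1 (gP n) n.
apply/(closed_cylinder_projectionP x w (cF _)) => m.
have := gP (maxn n m); rewrite size_mkseq.
rewrite -(cat_take_drop n (mkseq g _)) -(cat_take_drop m (mkseq w _)).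
rewrite !take_mkseq ?leq_maxl ?leq_maxr //.
by apply: cylinder_projectionS; exact: Fmon.
Qed.

Lemma Pi11_rank_tree (X : topologicalType) (K : Type) (lt : K -> K -> Prop)
    (B : set (X * Baire_space)) : omega1_order lt -> Pi11 _ B ->
  exists G : seq nat -> seq nat -> set X, (forall s u, closed (G s u)) /\
  forall x w, B (x, w) <-> exists f : seq nat -> K, forall s i,
    G (rcons s i) (mkseq w (size (rcons s i))) x -> lt (f (rcons s i)) (f s).
Proof.
move=> lt_omega1 /Suslin_section_tree[G [cG Gmon GB]].
exists G; split=> // x w; pose tree s := G s (mkseq w (size s)) x.
have tree_closed : prefix_closed tree.
  move=> s t; rewrite /tree size_cat -(cat_take_drop (size s) (mkseq w _)).
  by rewrite take_mkseq ?leq_addr //; exact: Gmon.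
rewrite -(no_branch_rankP lt_omega1 (countableP _) tree_closed).
by split=> [Bxw /GB //|nbr]; apply: contrapT => /GB.
Qed.

Lemma Pi11_Sigma12 (X : topologicalType) : Pi11 X `<=` Sigma12 X.
Proof.
move=> A pA; exists (fst @^-1` A).
  by apply: (Suslin_preimage _ pA) => p; exact: cvg_fst.
apply/seteqP; split=> [_ [p Ap <-]//|x Ax].
by exists (x, (fun=> 0%N) : Baire_space).
Qed.

Definition open_sets_Fsigma (X : topologicalType) :=
  forall U : set X, open U -> Fsigma U.

Lemma pseudoMetric_open_sets_Fsigma (R : realType) (X : pseudoMetricType R) :
  open_sets_Fsigma X.
Proof.
move=> U oU; pose ball_nbhd (V : set X) n :=
  \bigcup_(y in V) (ball y (n.+1%:R^-1 : R)%R)°.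
exists (fun n => ~` ball_nbhd (~` U) n).
  move=> n; apply: open_closedC; apply: bigcup_open => y _.
  exact: open_interior.
apply/seteqP; split=> [x Ux|x [n _ nx]]; last first.
  apply: contrapT => nUx; apply: nx; exists x => //.
  exact: nbhsx_ballx.
have /nbhs_ballP[e e0 xeU] : nbhs x U by exact: open_nbhs_nbhs.
have [n ne] : exists n : nat, (n.+1%:R^-1 < e :> R)%R.
  have [n _ /(_ n (leqnn n))] := near_infty_natSinv_lt (PosNum e0).
  by exists n.
exists n => // -[y nUy /interior_subset xy]; apply: nUy; apply: xeU.
exact/ball_sym/(le_ball (ltW ne)).
Qed.

Section SuslinPointclasses.
Variable X : topologicalType.
Hypothesis X_Fsigma : open_sets_Fsigma X.

Lemma open_Sigma11 (U : set X) : open U -> Sigma11 X U.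
Proof.
move=> /X_Fsigma[F cF ->]; apply: Suslin_bigcup => n.
exact: (closed_Suslin 0%N).
Qed.

Lemma Borel_Sigma11_Pi11 : Borel X `<=` Sigma11 X `&` Pi11 X.
Proof.
apply: smallest_sub => [|U oU]; last first.
  split; first exact: open_Sigma11.
  by apply: (closed_Suslin 0%N); exact: open_closedC.
split=> [|A [sA pA]|A sA].
- split; first exact: Suslin_set0.
  by rewrite /Pi11 /= setC0; apply: (closed_Suslin 0%N); exact: closedT.
- by rewrite setTD; split=> //; rewrite /Pi11 /= setCK.
- split; first by apply: Suslin_bigcup => n; have [] := sA n.
  rewrite /Pi11 /= setC_bigcup.
  by apply: (Suslin_bigcap 0%N) => n; have [] := sA n.
Qed.

Lemma closed_implication_Suslin (K : choiceType) (C : set X) (p : Prop) :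
  [set: nat] #<= [set: K] -> closed C -> Suslin X K [set x | C x -> p].
Proof.
move=> nat_le_K cC; apply: (Suslin_card_le nat_le_K); apply: open_Sigma11.
have [Hp|np] := pselect p.
  rewrite (_ : mkset _ = setT); first exact: openT.
  by apply/seteqP; split=> // x _ _.
rewrite (_ : mkset _ = ~` C); first exact: closed_openC.
by apply/seteqP; split=> x nC // /nC.
Qed.

(* Shoenfield's tree: a witness consists of a point [w] of the Baire space and
   of a rank function on the tree that searches for a proof of [~ B (x, w)]. *)
Lemma Sigma12_Suslin (K : choiceType) (lt : K -> K -> Prop) :
  omega1_order lt -> Sigma12 X `<=` Suslin X K.
Proof.
move=> lt_omega1 _ [B /(Pi11_rank_tree lt_omega1)[G [cG BG]] <-].
have [k0] := omega1_inhabited lt_omega1.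
have /infiniteP nat_le_K := omega1_infinite lt_omega1.
have [e [d eK]] := card_le_cancel 0%N nat_le_K.
pose point (q : nat + seq nat -> K) m := d (q (inl m)).
pose Phi (c : seq nat * nat) (q : nat + seq nat -> K) : set X :=
  let s := rcons c.1 c.2 in
  [set x | G s (mkseq (point q) (size s)) x -> lt (q (inr s)) (q (inr c.1))].
rewrite (_ : fst @` B = [set x | exists q, forall c, Phi c q x]).
  apply: (@conditions_Suslin _ _ k0 _ _ _ (fun c => let s := rcons c.1 c.2 in
    map inl (iota 0 (size s)) ++ [:: inr c.1; inr s])).
    by move=> c q; exact: (closed_implication_Suslin _ nat_le_K (cG _ _)).
  move=> [s i] q q' qq'; rewrite /Phi /= -!qq' ?mem_cat ?inE ?eqxx ?orbT //.
  rewrite (_ : mkseq (point q) _ = mkseq (point q') (size (rcons s i))) //.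
  apply/eq_mkseqP => m ms; rewrite /point qq' //.
  by rewrite mem_cat map_f // mem_iota.
apply/seteqP; split=> x.
  move=> [[{}x w] /BG[f f_rank] <-] /=.
  exists (fun j => match j with inl m => e (w m) | inr s => f s end) => -[s i].
  rewrite /Phi /= /point (_ : (fun m => _) = w); first exact: f_rank.
  by apply/funext => m; rewrite eK.
move=> [q xq]; exists (x, point q) => //; apply/BG.
by exists (q \o inr) => s i; exact: (xq (s, i)).
Qed.

End SuslinPointclasses.

(** * Suslin sets as unions of Borel sets *)

Section BorelSets.
Variable X : topologicalType.
Implicit Types A B : set X.

Lemma Borel_setC A : Borel X A -> Borel X (~` A).
Proof. by rewrite -setTD; exact: sigma_algebraCD. Qed.

Lemma Borel_setU A B : Borel X A -> Borel X B -> Borel X (A `|` B).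
Proof.
move=> bA bB; rewrite -bigcup2E; apply: sigma_algebra_bigcup => -[|[|n]] //=.
exact: sigma_algebra0.
Qed.

Lemma Borel_setD A B : Borel X A -> Borel X B -> Borel X (A `\` B).
Proof.
move=> bA bB; rewrite setDE -(setCK A) -setCU; apply: Borel_setC.
by apply: Borel_setU => //; exact: Borel_setC.
Qed.

Lemma Borel_bigcup (I : Type) (D : set I) (F : I -> set X) :
  countable D -> (forall i, D i -> Borel X (F i)) ->
  Borel X (\bigcup_(i in D) F i).
Proof.
move=> /pfcard_geP[->|[f]] bF.
  by rewrite bigcup_set0; exact: sigma_algebra0.
rewrite (reindex_bigcup f setT); [|exact: funS|exact: surj].
by apply: sigma_algebra_bigcup => n; apply: bF; exact: funS.
Qed.

Lemma Borel_bigcap (I : Type) (D : set I) (F : I -> set X) :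
  countable D -> (forall i, D i -> Borel X (F i)) ->
  Borel X (\bigcap_(i in D) F i).
Proof.
move=> cD bF; rewrite -[X in Borel _ X]setCK setC_bigcap; apply: Borel_setC.
by apply: Borel_bigcup => // i Di; apply: Borel_setC; exact: bF.
Qed.

Lemma closed_Borel A : closed A -> Borel X A.
Proof.
move=> cA; rewrite -(setCK A); apply: Borel_setC; apply: sub_sigma_algebra.
exact: closed_openC.
Qed.

End BorelSets.

Definition indexed_unions (X K : Type) (Gamma : set (set X)) : set (set X) :=
  [set A | exists2 E : K -> set X, (forall a, Gamma (E a)) & A = \bigcup_a E a].

Definition indexed_disjoint_unions (X K : Type) (Gamma : set (set X)) :
    set (set X) :=
  [set A | exists E : K -> set X,
    [/\ forall a, Gamma (E a), trivIset setT E & A = \bigcup_a E a]].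

Arguments indexed_unions {X} K Gamma.
Arguments indexed_disjoint_unions {X} K Gamma.

Lemma indexed_unions_bigcup (X K : Type) (Gamma : set (set X))
    (A : K -> set X) (k0 : K) : [set: K * K] #<= [set: K] ->
  (forall a, indexed_unions K Gamma (A a)) ->
  indexed_unions K Gamma (\bigcup_a A a).
Proof.
move=> KK /(_ _)/cid2-/all_sig2[E GE AE].
have [f [g fK]] := card_le_cancel (k0, k0) KK.
exists (fun k => E (g k).1 (g k).2) => [k|]; first exact: GE.
apply/seteqP; split=> x [a _].
  by rewrite AE => -[b _ Eabx]; exists (f (a, b)) => //; rewrite fK.
by move=> Ex; exists (g a).1 => //; rewrite AE; exists (g a).2.
Qed.

Section BorelUnions.
Variables (X : topologicalType) (K : choiceType) (lt : K -> K -> Prop).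
Hypothesis lt_omega1 : omega1_order lt.

Section CountableTrees.
Variables (T : Type) (F : seq T -> set X).
Hypotheses (T_countable : countable [set: T]) (bF : forall s, Borel X (F s)).

Let pruned_set a s : set X := [set x | pruned lt (F ^~ x) a s].

Lemma Borel_pruned a s : Borel X (pruned_set a s).
Proof.
elim/(well_founded_ind (omega1_wf lt_omega1)) : a s => a IH s.
rewrite (_ : pruned_set a s = ~` F s `|`
    \bigcup_(b in [set b | lt b a]) \bigcap_i pruned_set b (rcons s i)).
  apply: Borel_setU; first exact: Borel_setC.
  apply: Borel_bigcup => [|b ba]; first exact: omega1_countable_lt lt_omega1 _.
  by apply: Borel_bigcap => // i _; exact: IH.
apply/seteqP; split=> x.
  move=> /prunedP[nFx|[b ba sb]]; [by left|right].
  by exists b => // i _; exact: sb.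
move=> [nFx|[b ba sb]]; apply/prunedP; [by left|right].
by exists b => // i; exact: sb.
Qed.

Lemma Borel_stable_stage a :
  Borel X [set x | stable_stage lt (F ^~ x) a].
Proof.
rewrite (_ : mkset _ = \bigcap_s (pruned_set a s `|`
    ~` \bigcap_i pruned_set a (rcons s i))).
  apply: Borel_bigcap => [|s _]; first exact: countable_seq.
  apply: Borel_setU; first exact: Borel_pruned.
  apply: Borel_setC; apply: Borel_bigcap => // i _; exact: Borel_pruned.
apply/seteqP; split=> x xa s => [_|sa].
  have [sa|nsa] := pselect (pruned_set a s x); first by left.
  by right=> children; apply: nsa; apply: xa => i; exact: children.
by have [//|[]] := xa s I; move=> i _; exact: sa.
Qed.

Lemma suslin_operation_Borel_union :
  indexed_unions K (Borel X) (suslin_operation F).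
Proof.
exists (fun a => [set x | stable_stage lt (F ^~ x) a] `\` pruned_set a [::]).
  move=> a; apply: Borel_setD; first exact: Borel_stable_stage.
  exact: Borel_pruned.
apply/seteqP; split=> x.
  by move=> /(has_branch_stableP lt_omega1 _ T_countable)[a]; exists a.
move=> [a _ [a_stable nroot]].
by apply/(has_branch_stableP lt_omega1 _ T_countable); exists a.
Qed.

End CountableTrees.

(* A sequence in omega_1 is bounded, so that the alphabet [K] may be replaced by
   its countable initial segments. *)
Lemma Suslin_Borel_union : Suslin X K `<=` indexed_unions K (Borel X).
Proof.
move=> A /Suslin_closed_scheme[F [cF _ ->]].
pose below b := set_type [set c | lt c b].
rewrite (_ : suslin_operation F =
    \bigcup_b suslin_operation (fun s : seq (below b) => F (map val s))).
  have [k0] := omega1_inhabited lt_omega1.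
  apply: (indexed_unions_bigcup k0 (omega1_sqr lt_omega1)) => b.
  apply: suslin_operation_Borel_union => [|s]; last exact: closed_Borel.
  by rewrite (eq_countable (card_setT _)); exact: omega1_countable_lt.
apply/seteqP; split=> x [].
  move=> g Fg; have [|b gb] := omega1_bounded lt_omega1 (A := range g).
    exact: sub_countable (card_image_le g setT) (countableP _).
  have glt n : g n \in [set c | lt c b] by rewrite inE; apply: gb; exists n.
  exists b => //; exists (fun n => SigSub (glt n) : below b) => n.
  by rewrite map_mkseq; exact: Fg.
by move=> b _ [g Fg]; exists (val \o g) => n; rewrite -map_mkseq; exact: Fg.
Qed.

Lemma Borel_unions_disjoint :
  indexed_unions K (Borel X) `<=` indexed_disjoint_unions K (Borel X).
Proof.
move=> _ [E bE ->].
exists (fun a => E a `\` \bigcup_(b in [set b | lt b a]) E b); split.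
- move=> a; apply: Borel_setD => //; apply: Borel_bigcup => //.
  exact: omega1_countable_lt lt_omega1 _.
- move=> a b _ _ [x [[Ea nEa] [Eb nEb]]].
  have [//|ab|ba] := omega1_trichotomy lt_omega1 a b.
  + by case: nEb; exists a.
  + by case: nEa; exists b.
- apply/seteqP; split=> [x [a _ Ea]|x [a _ [Ea _]]]; last by exists a.
  have lt_wf := omega1_wf lt_omega1.
  have [|b Eb b_min] := well_founded_minimal (A := E ^~ x) lt_wf.
    by exists a.
  by exists b => //; split=> // -[c cb Ec]; exact: b_min Ec cb.
Qed.

End BorelUnions.

(** * Refining partitions *)

Section Refinement.
Variables (X K : Type) (P : set (set X)) (E : set X -> K -> set X).
Hypothesis E_split : forall A, P A ->
  trivIset setT (E A) /\ A = \bigcup_a E A a.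

Definition refinement : set (set X) :=
  [set B | B !=set0 /\ exists2 A, P A & range (E A) B].

Lemma piece_subset A a : P A -> E A a `<=` A.
Proof. by move=> /E_split[_ {2}->]; exact: bigcup_sup. Qed.

Lemma partition_refinement (Y : set X) :
  partition P id Y -> partition refinement id Y.
Proof.
move=> [Pcover Ptriv P0]; split; last by move=> B [].
- rewrite -Pcover; apply/seteqP; split=> x.
    move=> [_ [_ [A PA [a _ <-]]] xa].
    by exists A => //; exact: piece_subset xa.
  move=> [A PA]; have [_ {1}->] := E_split PA; move=> [a _ xa].
  by exists (E A a) => //; split; [exists x|exists A => //; exists a].
- move=> _ _ [_ [A PA [a _ <-]]] [_ [A' PA' [a' _ <-]]] [x [xa xa']].
  have AA' : A = A'.
    apply: Ptriv => //; exists x.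
    by split; [exact: piece_subset xa|exact: piece_subset xa'].
  rewrite -AA' in xa' *; have [Etriv _] := E_split PA.
  by congr (E A _); apply: Etriv => //; exists x.
Qed.

Lemma card_refinement (Y : set X) :
  partition P id Y -> P `*` [set: K] #<= P -> refinement #= P.
Proof.
move=> [_ Ptriv P0] PK; apply/card_eqPle; split.
  apply: card_le_trans PK; apply/card_le_relP.
  exists (fun B p => B = E p.1 p.2); split; last by move=> B B' p _ _ -> ->.
  by move=> B [_ [A PA [a _ <-]]]; exists (A, a).
apply/card_le_relP; exists (fun A B => B !=set0 /\ B `<=` A); split.
  move=> A PA; have [x Ax] := P0 _ PA.
  have [_ AE] := E_split PA; rewrite AE in Ax; have [a _ xa] := Ax.
  have Ea0 : E A a !=set0 by exists x.
  exists (E A a); first by split=> //; exists A => //; exists a.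
  by split=> //; exact: piece_subset.
move=> A A' B PA PA' [[x Bx] BA] [_ BA'].
by apply: Ptriv => //; exists x; split; [exact: BA|exact: BA'].
Qed.

End Refinement.

Lemma sub_sp (X : topologicalType) (Gamma Delta : set (set X)) :
  Gamma `<=` Delta -> sp Gamma `<=` sp Delta.
Proof.
move=> GD _ [P [pP ucP PG] <-]; exists P => //; split=> //.
exact: subset_trans GD.
Qed.

Lemma eq_cardinality (T : Type) (A B : set T) :
  A #= B -> cardinality A = cardinality B.
Proof.
by move=> AB; apply/seteqP; split=> C; rewrite /cardinality /= (card_eqr AB).
Qed.

Lemma sp_refine (X : topologicalType) (K : Type) (Gamma Delta : set (set X)) :
  (forall P : set (set X), ~ countable P -> P `*` [set: K] #<= P) ->
  Gamma `<=` indexed_disjoint_unions K Delta -> sp Gamma `<=` sp Delta.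
Proof.
move=> absorbK GD _ [P [P_partition ucP PG] <-].
have /choice[E EP] A : exists E : K -> set X, P A ->
    [/\ forall a, Delta (E a), trivIset setT E & A = \bigcup_a E a].
  have [/PG/GD[E EP]|nPA] := pselect (P A); first by exists E.
  by exists (fun=> set0).
have E_split A : P A -> trivIset setT (E A) /\ A = \bigcup_a E A a.
  by move=> /EP[].
have PE := card_refinement E_split P_partition (absorbK _ ucP).
exists (refinement P E); last exact: eq_cardinality.
split; first exact: partition_refinement.
  by rewrite (eq_countable PE).
by move=> _ [_ [A PA [a _ <-]]]; have [] := EP _ PA.
Qed.

Lemma sp_aleph1_Suslin_Borel (X : topologicalType) :
  sp (aleph1_Suslin X) `<=` sp (Borel X).
Proof.
have [K [lt lt_omega1]] := exists_omega1_order.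
apply: (@sp_refine _ K) => [P|A [K' K'1 AK']].
  exact: uncountable_setX_omega1 lt_omega1 _ _.
apply: (Borel_unions_disjoint lt_omega1); apply: (Suslin_Borel_union lt_omega1).
apply: Suslin_card_le AK'; apply: is_aleph1_card_le K'1 _.
exact: omega1_uncountable lt_omega1.
Qed.

Lemma sp_eq_Borel (X : topologicalType) (Gamma : set (set X)) :
  Borel X `<=` Gamma -> Gamma `<=` aleph1_Suslin X -> sp Gamma = sp (Borel X).
Proof.
move=> BorelG Galeph1; apply/seteqP; split; last exact: sub_sp.
exact: subset_trans (sub_sp Galeph1) (@sp_aleph1_Suslin_Borel X).
Qed.

Lemma Sigma11_aleph1_Suslin (X : topologicalType) :
  Sigma11 X `<=` aleph1_Suslin X.
Proof.
have [K [lt lt_omega1]] := exists_omega1_order.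
move=> A SA; exists K; first exact: omega1_is_aleph1 lt_omega1.
by apply: Suslin_card_le SA; exact/infiniteP/(omega1_infinite lt_omega1).
Qed.

Lemma Sigma12_aleph1_Suslin (X : topologicalType) :
  open_sets_Fsigma X -> Sigma12 X `<=` aleph1_Suslin X.
Proof.
have [K [lt lt_omega1]] := exists_omega1_order.
move=> X_Fsigma A SA; exists K; first exact: omega1_is_aleph1 lt_omega1.
exact: (Sigma12_Suslin X_Fsigma lt_omega1).
Qed.

Theorem theorem5p2 (R : realType) :
  [/\ sp (Borel R) = sp (Sigma11 R),
      sp (Sigma11 R) = sp (Pi11 R),
      sp (Pi11 R) = sp (Sigma12 R)
    & sp (Sigma12 R) = sp (aleph1_Suslin R)].
Proof.
have R_Fsigma : open_sets_Fsigma R by exact: pseudoMetric_open_sets_Fsigma.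
have Borel_Sigma11 : Borel R `<=` Sigma11 R.
  by move=> A /(Borel_Sigma11_Pi11 R_Fsigma)[].
have Borel_Pi11 : Borel R `<=` Pi11 R.
  by move=> A /(Borel_Sigma11_Pi11 R_Fsigma)[].
have Borel_Sigma12 := subset_trans Borel_Pi11 (@Pi11_Sigma12 R).
have Sigma12_aleph1 := Sigma12_aleph1_Suslin R_Fsigma.
have Pi11_aleph1 := subset_trans (@Pi11_Sigma12 R) Sigma12_aleph1.
rewrite (sp_eq_Borel Borel_Sigma11 (@Sigma11_aleph1_Suslin R)).
rewrite (sp_eq_Borel Borel_Pi11 Pi11_aleph1).
rewrite (sp_eq_Borel Borel_Sigma12 Sigma12_aleph1).
by rewrite (sp_eq_Borel (subset_trans Borel_Sigma12 Sigma12_aleph1)).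
Qed.
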